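(* Let $\gamma$ denote the Euler–Mascheroni constant and $H_n=\sum_{k=1}^n \frac1k$ the $n$-th harmonic number. The entire function $$f(x):=\sum_{n=0}^{\infty} \frac{H_{n+2}-\gamma}{n!}\,\frac{x^n}{n!}$$ belongs to $\mathscr{L}\text{-}\mathscr{P}^+$, and hence the sequence $\left\{\frac{H_{n+2}-\gamma}{n!}\right\}_{n=0}^{\infty}$ is a multiplier sequence.
   Context: A real entire function $\varphi(x)=\sum_{k=0}^\infty \frac{\gamma_k}{k!}x^k$ is said to be of type I in the Laguerre–Pólya class if $\varphi(x)$ or $\varphi(-x)$ can be written as $c x^m e^{\sigma x}\prod_{k=1}^{\omega}\left(1+\frac{x}{x_k}\right)$, where $c\in\mathbb{R}$, $m$ is a non-negative integer, $\sigma\ge 0$, $x_k>0$, $0\le\omega\le\infty$ and $\sum_{k=1}^{\omega}\frac1{x_k}<+\infty$. If in addition $\gamma_k\ge 0$ for all $k=0,1,2,\ldots$, we write $\varphi\in\mathscr{L}\text{-}\mathscr{P}^+$. A sequence of real numbers $\{\gamma_k\}_{k=0}^\infty$ is a multiplier sequence if the linear operator $T$ on real polynomials defined by $T[x^k]=\gamma_kx^k$, $k=0,1,2,\ldots$, has the property that $T[p]$ has no non-real zeros whenever the real polynomial $p$ has no non-real zeros (the zero polynomial is regarded as having no non-real zeros). *)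

(* Defs.v *)
From HB Require Import structures.
From mathcomp Require Import all_boot all_order all_algebra complex.
From mathcomp Require Import all_classical all_reals all_analysis.

Set Implicit Arguments.
Unset Strict Implicit.
Unset Printing Implicit Defensive.

Import Order.TTheory GRing.Theory Num.Theory numFieldNormedType.Exports.

Local Open Scope classical_set_scope.
Local Open Scope ring_scope.
Local Open Scope complex_scope.

(* R[i] carries no topology of its own; it gets the topology of its modulus
   once it is viewed as a numClosedFieldType. *)
Definition Cplx (R : realType) : numClosedFieldType := R[i].

Definition egf_terms (R : realType) (g : nat -> R) (z : Cplx R) (k : nat) :
  Cplx R := (g k / k`!%:R)%:C * z ^+ k.

(* [phi] is the real entire function with Maclaurin coefficients g k / k!:
   convergence at every complex z makes [phi] entire. *)
Definition real_entire (R : realType) (g : nat -> R)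
  (phi : Cplx R -> Cplx R) : Prop :=
  forall z : Cplx R, series (egf_terms g z) @ \oo --> phi z.

Definition egf (R : realType) (g : nat -> R) (z : Cplx R) : Cplx R :=
  limn (series (egf_terms g z)).

(* The library's expR and exp_coeff only cover real arguments. *)
Definition cexp (R : realType) (z : Cplx R) : Cplx R :=
  limn (series (fun k : nat => z ^+ k / k`!%:R)).

(* The number of zeros, a natural number or infinity (None); they are indexed
   from 0. *)
Definition below (omega : option nat) (k : nat) : bool :=
  if omega is Some w then (k < w)%N else true.

(* The infinite product is the limit of its partial products, which exists
   because sum 1 / x_k converges. *)
Definition LP_factorization (R : realType) (phi : Cplx R -> Cplx R) : Prop :=
  exists (c : R) (m : nat) (sigma : R) (omega : option nat) (x : nat -> R),
    [/\ 0 <= sigma,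
        forall k, below omega k -> 0 < x k,
        cvgn (fun n : nat => \sum_(0 <= k < n | below omega k) (x k)^-1)
      & forall z : Cplx R,
          phi z = c%:C * z ^+ m * cexp (sigma%:C * z) *
            limn (fun n : nat =>
              \prod_(0 <= k < n | below omega k) (1 + z / (x k)%:C) : Cplx R)].

Definition LP_typeI (R : realType) (phi : Cplx R -> Cplx R) : Prop :=
  (exists g : nat -> R, real_entire g phi) /\
  (LP_factorization phi \/ LP_factorization (fun z => phi (- z))).

Definition LP_plus (R : realType) (phi : Cplx R -> Cplx R) : Prop :=
  LP_typeI phi /\
  exists g : nat -> R, real_entire g phi /\ forall k, 0 <= g k.

Definition only_real_zeros (R : realType) (p : {poly R}) : Prop :=
  p = 0 \/
  forall z : Cplx R, root (map_poly (real_complex R) p) z -> z \is Num.real.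

(* The linear operator with 'X^k |-> g k *: 'X^k. *)
Definition diag_op (R : realType) (g : nat -> R) (p : {poly R}) : {poly R} :=
  \sum_(k < size p) p`_k *: (g k *: 'X^k).

Definition multiplier_sequence (R : realType) (g : nat -> R) : Prop :=
  forall p : {poly R}, only_real_zeros p -> only_real_zeros (diag_op g p).

(* [series harmonic n] is the n-th harmonic number, since harmonic k = 1/(k+1). *)
Definition euler_mascheroni (R : realType) : R :=
  limn (fun n : nat => series harmonic n - ln n%:R : R).

Definition gamma_seq (R : realType) (n : nat) : R :=
  (series harmonic n.+2 - euler_mascheroni R) / n`!%:R.

(* Main.v *)
Require Import Defs.
From mathcomp Require Import all_boot all_order all_algebra complex.
From mathcomp Require Import all_classical all_reals all_analysis.
From mathcomp Require Import ring lra.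

(** Since H_(n+2) - gamma = psi(n+3) for the digamma function psi, the sequence
    is the restriction to the integers of Phi(s) = psi(s+3) / Gamma(s+1).  The
    zeros of 1/Gamma(s+1) absorb the poles of psi(s+3), and Phi is an entire
    function of the Laguerre-Polya class all of whose zeros are negative; by
    a theorem of Laguerre such a function yields a multiplier sequence.

    Multiplier sequence.  Truncating the product for 1/Gamma and the series for
    psi replaces Phi by a polynomial times an exponential.  With
    W = prod_(i < N) (X + i + 3) and L = H_(N+2) - gamma, put
      Phi_N(s) = (s+1) (s+2) (L W - W')(s) / ((N+2)! (N+2)^s).
    Then Phi_N(n) -> (H_(n+2) - gamma) / n! as N grows.  The factor
    L W - W' = W (L - sum_i 1/(s+i+3)) has only real zeros because the sum has
    a nonzero imaginary part off the real axis ([Im_partial_fraction]), and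
    they are negative because at s >= 0 the second factor is at least
    H_2 - gamma > 0.  A linear factor n + a with a > 0 is a multiplier
    sequence, since it acts as p |-> X p' + a p and the same partial fraction
    argument applies to p'/p ([multiplier_sequence_shift]); multiplier
    sequences are closed under products, contain c^n, and pass to limits
    ([multiplier_sequence_lim]), because a real-rooted p of degree d satisfies
    |p(z)| >= |lead p| |Im z|^d.

    Factorization.  For a positive multiplier sequence g, the polynomials
    f_n = sum_k C(n+1, k) (n+1)^(-k) g_k X^k, the images of
    (1 + X/(n+1))^(n+1), are real-rooted with positive coefficients, hence
    f_n = g_0 prod_i (1 + y_(n,i) X) with y_(n,0) >= y_(n,1) >= ... >= 0.  Here
    g_k k! <= g_0 B^k, so that comparing y_(n,0) ... y_(n,i) with the
    coefficient of X^(i+1) gives y_(n,i) <= B e^2 / (i+1)^2, uniformly in n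
    ([jensen_poly_factors]).  This quadratic decay makes the tails of the
    products uniformly small, so a limit y of the y_(n,.) along an ultrafilter
    on the indices n satisfies f = g_0 prod_i (1 + y_i z), with no exponential
    factor ([egf_product]). *)

Set Implicit Arguments.
Unset Strict Implicit.
Unset Printing Implicit Defensive.

Import Order.TTheory GRing.Theory Num.Theory numFieldNormedType.Exports.

Local Open Scope classical_set_scope.
Local Open Scope ring_scope.
Local Open Scope complex_scope.

(** * Real zeros and partial fractions *)

(** The field R[i] is algebraically closed, so p splits over it; its roots
    being real, the factorization descends to R. *)
Lemma real_zeros_split (R : realType) (p : {poly R}) :
  p != 0 -> only_real_zeros p ->
  exists s : seq R, p = lead_coef p *: \prod_(r <- s) ('X - r%:P).
Proof.
move=> p0 [/eqP|]; first by rewrite (negbTE p0).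
move=> pR.
have [s sE] := closed_field_poly_normal
  (map_poly (real_complex R) p : {poly Cplx R}).
exists [seq complex.Re z | z <- s].
apply: (@map_poly_inj _ _ (real_complex R)); rewrite sE.
rewrite linearZ /= lead_coef_map; congr (_ *: _).
rewrite big_map rmorph_prod big_seq [RHS]big_seq; apply: eq_bigr => z zs.
rewrite rmorphB /= map_polyX map_polyC /=; congr (_ - _%:P).
rewrite RRe_real//; apply: pR; rewrite sE.
rewrite rootZ ?lead_coef_eq0 ?map_poly_eq0//.
by rewrite root_prod_XsubC.
Qed.

Lemma only_real_zerosI (R : realType) (p : {poly R}) :
  (forall z : Cplx R, complex.Im z != 0 ->
     (map_poly (real_complex R) p).[z] != 0) ->
  only_real_zeros p.
Proof.
move=> h; right=> z; apply: contraLR => zN; apply: h.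
by case: z zN => a b; rewrite complex_real.
Qed.

(** Each summand w / (z - r) contributes -w (Im z)^2 / |z - r|^2 to the
    product of the imaginary parts. Hence such a sum takes no real value off
    the real axis, which is how every real-rootedness statement below about
    derivatives is obtained. *)
Lemma Im_partial_fraction (R : realType) (s : seq (R * R)) (z : Cplx R) :
  complex.Im z != 0 -> {in s, forall w, 0 < w.1} -> s != [::] ->
  complex.Im z * complex.Im (\sum_(w <- s) w.1%:C / (z - w.2%:C)) < 0.
Proof.
move=> z0; elim: s => // w s IH ws _.
have ImD (x y : Cplx R) : complex.Im (x + y) = complex.Im x + complex.Im y.
  by case: x y => ? ? [].
have w0 : complex.Im z * complex.Im (w.1%:C / (z - w.2%:C)) < 0.
  have {ws IH}: 0 < w.1 by apply: ws; rewrite mem_head.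
  case: z z0 w => a b /= b0 [m r] /= m0.
  rewrite mul0r !addr0 !oppr0 !addr0.
  have q0 : 0 < (a - r) ^+ 2 + b ^+ 2.
    by rewrite ltr_wpDl ?sqr_ge0// lt0r sqr_ge0 sqrf_eq0 b0.
  rewrite (_ : _ * _ = - (m * b ^+ 2 / ((a - r) ^+ 2 + b ^+ 2))); last by ring.
  by rewrite oppr_lt0 divr_gt0// mulr_gt0// lt0r sqr_ge0 sqrf_eq0 b0.
rewrite big_cons ImD mulrDr.
case: s IH ws => [|w' s] IH ws.
  by rewrite big_nil (_ : complex.Im 0 = 0 :> R)// mulr0 addr0.
rewrite -[ltRHS]addr0 ltrD// IH// => x xs; apply: ws.
by rewrite inE xs orbT.
Qed.

Lemma horner_deriv_prod_XsubC (F : fieldType) (s : seq F) (z : F) :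
  z \notin s ->
  (\prod_(r <- s) ('X - r%:P))^`().[z] =
    (\prod_(r <- s) ('X - r%:P)).[z] * \sum_(r <- s) (z - r)^-1.
Proof.
elim: s => [|r s IH]; first by rewrite !big_nil -polyC1 derivC horner0 mulr0.
rewrite inE negb_or => /andP[zr zs].
rewrite !big_cons derivM derivXsubC mul1r hornerD !hornerM IH//.
rewrite hornerXsubC mulrDr mulrAC divff ?subr_eq0// mul1r.
by rewrite mulrA.
Qed.

Lemma notin_real_seq (R : realType) (s : seq R) (z : Cplx R) :
  complex.Im z != 0 -> z \notin [seq r%:C | r <- s].
Proof. by apply: contra => /mapP[r _ ->]. Qed.

Lemma horner_deriv_prod_real (R : realType) (c : R) (s : seq R) (z : Cplx R) :
  complex.Im z != 0 ->
  let p := c *: \prod_(r <- s) ('X - r%:P) in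
  (map_poly (real_complex R) p^`()).[z] =
    (map_poly (real_complex R) p).[z] * \sum_(r <- s) (z - r%:C)^-1.
Proof.
move=> z0 p; rewrite -deriv_map /p linearZ /= rmorph_prod.
under eq_bigr do rewrite rmorphB /= map_polyX map_polyC /=.
have := horner_deriv_prod_XsubC (notin_real_seq s z0).
rewrite !big_map derivZ !hornerZ => ->.
by rewrite mulrA.
Qed.

Lemma horner_prod_real_neq0 (R : realType) (c : R) (s : seq R) (z : Cplx R) :
  c != 0 -> complex.Im z != 0 ->
  (map_poly (real_complex R) (c *: \prod_(r <- s) ('X - r%:P))).[z] != 0.
Proof.
move=> c0 z0; rewrite linearZ /= rmorph_prod.
under eq_bigr do rewrite rmorphB /= map_polyX map_polyC /=.
rewrite hornerZ mulf_neq0 ?fmorph_eq0//.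
have := notin_real_seq s z0.
by rewrite -root_prod_XsubC big_map.
Qed.

(** * Multiplier sequences *)

Lemma coef_diag_op (R : realType) (g : nat -> R) (p : {poly R}) k :
  (diag_op g p)`_k = g k * p`_k.
Proof.
rewrite /diag_op.
under eq_bigr do rewrite scalerA.
rewrite -(poly_def (size p) (fun k => p`_k * g k)) coef_poly [RHS]mulrC.
by case: ltnP => // /(nth_default 0) ->; rewrite mul0r.
Qed.

Lemma horner_diag_op (R : realType) (g : nat -> R) (p : {poly R}) z :
  (map_poly (real_complex R) (diag_op g p)).[z] =
  \sum_(k < size p) (g k * p`_k)%:C * z ^+ k.
Proof.
rewrite (@horner_coef_wide _ (size p)); last first.
  rewrite size_map_poly; apply/leq_sizeP => j sj.
  by rewrite coef_diag_op nth_default// mulr0.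
by apply: eq_bigr => k _; rewrite coef_map coef_diag_op.
Qed.

Lemma multiplier_sequenceM (R : realType) (g h : nat -> R) :
  multiplier_sequence g -> multiplier_sequence h ->
  multiplier_sequence (fun k => g k * h k).
Proof.
move=> gP hP p pR.
have -> : diag_op (fun k => g k * h k) p = diag_op g (diag_op h p).
  by apply/polyP => k; rewrite !coef_diag_op mulrA.
exact/gP/hP.
Qed.

(** This is the substitution X |-> c X, up to the scalar a. *)
Lemma multiplier_sequence_exp (R : realType) (a c : R) :
  a != 0 -> c != 0 -> multiplier_sequence (fun k => a * c ^+ k).
Proof.
move=> a0 c0 p [->|pR].
  by left; apply/polyP => k; rewrite coef_diag_op !coef0 mulr0.
right=> z; rewrite /root horner_diag_op.
have -> : \sum_(k < size p) (a * c ^+ k * p`_k)%:C * z ^+ k =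
    a%:C * (map_poly (real_complex R) p).[c%:C * z].
  rewrite (@horner_coef_wide _ (size p)) ?size_map_poly// mulr_sumr.
  apply: eq_bigr => k _; rewrite coef_map /= exprMn !rmorphM rmorphXn /=.
  by ring.
rewrite mulf_eq0 fmorph_eq0 (negbTE a0) /= => /pR czR.
have -> : z = c^-1%:C * (c%:C * z) by rewrite mulrA -rmorphM mulVf// mul1r.
by rewrite realM//; apply/complex_realP; exists c^-1.
Qed.

(** The operator is p |-> X p' + a p, whose value at z is z p(z) (a / z +
    sum_r 1 / (z - r)) over the roots r of p: a partial fraction with positive
    weights and poles at 0 and at the roots of p. *)
Lemma multiplier_sequence_shift (R : realType) (a : R) :
  0 < a -> multiplier_sequence (fun k => k%:R + a).
Proof.
move=> a0 p pR; have [->|p0] := eqVneq p 0.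
  by left; apply/polyP => k; rewrite coef_diag_op !coef0 mulr0.
apply: only_real_zerosI => z z0.
have -> : diag_op (fun k => k%:R + a) p = 'X * p^`() + a *: p.
  apply/polyP => k; rewrite coef_diag_op coefD coefXM coefZ coef_deriv mulrDl.
  by rewrite mulr_natl; case: k.
have [s pE] := real_zeros_split p0 pR.
rewrite rmorphD rmorphM /= map_polyX hornerD hornerM hornerX map_polyZ hornerZ.
have lc0 : lead_coef p != 0 by rewrite lead_coef_eq0.
rewrite pE horner_deriv_prod_real//; set P := _.[z].
have P0 : P != 0 by exact: horner_prod_real_neq0.
have zn0 : z != 0 by apply: contraNneq z0 => ->.
have := @Im_partial_fraction R ((a, 0) :: [seq (1, r) | r <- s]) z z0.
rewrite big_cons big_map /= subr0.
under eq_bigr do rewrite mul1r.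
set S := \sum_(r <- s) _ => h.
have -> : z * (P * S) + a%:C * P = z * P * (a%:C / z + S) by field.
rewrite !mulf_neq0//; apply/eqP => S0; move: h; rewrite S0 mulr0 ltxx.
suff w0 : {in (a, 0) :: [seq (1, r) | r <- s], forall w, 0 < w.1}.
  by move/(_ w0 isT).
by move=> w; rewrite inE => /orP[/eqP ->//|/mapP[r _ ->]]; exact: ltr01.
Qed.

(** * The modulus of a complex number as a real number *)

Definition modC (R : realType) (z : Cplx R) : R := complex.Re `|z|.

Lemma modCE (R : realType) (z : Cplx R) : `|z| = (modC z)%:C.
Proof. by rewrite /modC normc_def. Qed.

Lemma modC_ge0 (R : realType) (z : Cplx R) : 0 <= modC z.
Proof. by rewrite -ler0c -modCE. Qed.

Lemma normC_real (R : realType) (x : R) : `|x%:C : Cplx R| = `|x|%:C.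
Proof. by rewrite normc_def /= expr0n addr0 sqrtr_sqr. Qed.

Lemma normIm_le (R : realType) (z : Cplx R) : `|complex.Im z|%:C <= `|z|.
Proof.
case: z => a b; rewrite normc_def lecR /= -sqrtr_sqr.
by rewrite ler_wsqrtr// lerDr sqr_ge0.
Qed.

Lemma modC_real (R : realType) (x : R) : modC (x%:C : Cplx R) = `|x|.
Proof. by rewrite /modC normC_real. Qed.

Lemma modCM (R : realType) (x y : Cplx R) : modC (x * y) = modC x * modC y.
Proof. by apply: complexI; rewrite rmorphM /= -!modCE normrM. Qed.

Lemma modCX (R : realType) (x : Cplx R) n : modC (x ^+ n) = modC x ^+ n.
Proof. by apply: complexI; rewrite rmorphXn /= -!modCE normrX. Qed.

Lemma modCB (R : realType) (x y : Cplx R) : modC (x - y) = modC (y - x).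
Proof. by apply: complexI; rewrite -!modCE distrC. Qed.

Lemma ler_modCD (R : realType) (x y : Cplx R) :
  modC (x + y) <= modC x + modC y.
Proof. by rewrite -lecR rmorphD /= -!modCE ler_normD. Qed.

Lemma ler_dist_modCD (R : realType) (x y z : Cplx R) :
  modC (x - z) <= modC (x - y) + modC (y - z).
Proof. by rewrite -[x - z](subrKA y) ler_modCD. Qed.

Lemma modC_le_ReIm (R : realType) (z : Cplx R) :
  modC z <= `|complex.Re z| + `|complex.Im z|.
Proof.
rewrite /modC normc_def /= -[leRHS]ger0_norm ?addr_ge0// -sqrtr_sqr.
apply: ler_wsqrtr; rewrite sqrrD !real_normK ?num_real// addrAC lerDl.
by rewrite mulrn_wge0// mulr_ge0.
Qed.

(** * Limits of multiplier sequences *)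

(** A root r of p is real, so |z - r| >= |Im z|. The coefficient of index d is
    used in place of the leading one so that the bound has the same shape for
    polynomials whose degree may drop, the left side being 0 in that case. *)
Lemma horner_real_zeros_ge (R : realType) (p : {poly R}) d (z : Cplx R) :
  only_real_zeros p -> (size p <= d.+1)%N ->
  (`|p`_d| * `|complex.Im z| ^+ d)%:C <= `|(map_poly (real_complex R) p).[z]|.
Proof.
move=> pR sp; have [->|pd0] := eqVneq p`_d 0.
  by rewrite normr0 mul0r normr_ge0.
have {}sp : size p = d.+1.
  apply/eqP; rewrite eqn_leq sp ltnNge; apply: contra pd0 => dp.
  by rewrite nth_default.
have p0 : p != 0 by rewrite -size_poly_gt0 sp.
have [s pE] := real_zeros_split p0 pR.
have ss : size s = d.
  apply/eqP; rewrite -eqSS -sp pE size_scale ?lead_coef_eq0//.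
  by rewrite size_prod_XsubC.
rewrite {2}pE map_polyZ rmorph_prod /= hornerZ normrM normC_real.
rewrite lead_coefE sp /= rmorphM ler_wpM2l ?ler0c//.
rewrite -ss horner_prod normr_prod.
elim: s {pE ss} => [|r s IH]; first by rewrite !big_nil expr0.
rewrite big_cons /= exprS rmorphM /= ler_pM ?ler0c// ?exprn_ge0//.
rewrite rmorphB /= map_polyX map_polyC hornerXsubC /=.
apply: le_trans (normIm_le _); case: (z) => a b /=.
by rewrite subr0.
Qed.

(** The images of p converge coefficientwise, so at a nonreal zero z of the
    limit their values tend to 0. They stay bounded away from 0 by the lower
    bound in terms of |Im z|, as the limiting leading coefficient g_d p_d does
    not vanish. *)
Lemma multiplier_sequence_lim (R : realType) (G : nat -> nat -> R)
    (g : nat -> R) :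
  (forall N, multiplier_sequence (G N)) ->
  (forall k, G ^~ k @ \oo --> g k) -> (forall k, g k != 0) ->
  multiplier_sequence g.
Proof.
move=> GM Gg g0 p pR; have [->|p0] := eqVneq p 0.
  by left; apply/polyP => k; rewrite coef_diag_op !coef0 mulr0.
apply: only_real_zerosI => z z0; apply/eqP => gz.
pose d := (size p).-1.
have pd0 : p`_d != 0 by rewrite -lead_coefE lead_coef_eq0.
pose E N := \sum_(k < size p) `|G N k - g k| * (`|p`_k| * modC z ^+ k).
have E0 : E @ \oo --> 0.
  rewrite (_ : 0 = \sum_(k < size p) 0 * (`|p`_k| * modC z ^+ k)); last first.
    by rewrite big1// => k _; rewrite mul0r.
  apply: cvg_big => [|k _]; [exact: add_continuous|apply: cvgMr_tmp].
  rewrite -(normr0 R) -(subrr (g k)); apply: cvg_norm.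
  by apply: cvgB; [exact: Gg|exact: cvg_cst].
have GE N : `|G N d * p`_d| * `|complex.Im z| ^+ d <= E N.
  rewrite -lecR -coef_diag_op.
  apply: le_trans (horner_real_zeros_ge z (GM N p pR) _) _.
    apply/leq_sizeP => j; rewrite /d => sj.
    rewrite coef_diag_op nth_default ?mulr0//.
    by rewrite prednK ?size_poly_gt0 in sj.
  rewrite -[X in `|X|]subr0 -gz !horner_diag_op -sumrB rmorph_sum /=.
  apply: le_trans (ler_norm_sum _ _ _) _; apply: ler_sum => k _.
  rewrite -mulrBl -rmorphB -mulrBl normrM normC_real normrM normrX modCE.
  by rewrite !rmorphM rmorphXn mulrA.
have : `|g d * p`_d| * `|complex.Im z| ^+ d <= 0.
  have lhs : `|G N d * p`_d| * `|complex.Im z| ^+ d @[N --> \oo] -->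
      `|g d * p`_d| * `|complex.Im z| ^+ d.
    by apply: cvgMr_tmp; apply: cvg_norm; apply: cvgMr_tmp; exact: Gg.
  apply: ler_cvg_to lhs E0 _.
  exact: nearW.
by rewrite leNgt mulr_gt0// ?exprn_gt0// normr_gt0// mulf_neq0.
Qed.

(** * The digamma sequence *)

(** Real and not in [0, +oo[, the zeros of p are negative: up to a constant, p
    is a product of factors X + a with a > 0. *)
Lemma multiplier_sequence_horner (R : realType) (p : {poly R}) :
  only_real_zeros p -> (forall x, 0 <= x -> p.[x] != 0) ->
  multiplier_sequence (fun k => p.[k%:R]).
Proof.
move=> pR pN.
have p0 : p != 0 by apply: contraNneq (pN 0 (lexx 0)) => ->; rewrite horner0.
have [s pE] := real_zeros_split p0 pR.
have sN r : r \in s -> r < 0.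
  move=> rs; rewrite ltNge; apply/negP => /pN/negP; apply.
  rewrite pE hornerZ mulf_eq0 -[X in _ || X]/(root _ _).
  by rewrite root_prod_XsubC rs orbT.
have lp0 : lead_coef p != 0 by rewrite lead_coef_eq0.
rewrite pE; move: (lead_coef p) lp0 => c c0 {pE p0 pN pR}.
elim: s sN => [|r s IH] sN.
  rewrite [X in multiplier_sequence X](_ : _ = fun k => c * 1 ^+ k).
    exact: multiplier_sequence_exp (oner_neq0 R).
  by apply/funext => k; rewrite big_nil hornerZ hornerC expr1n.
under eq_fun do rewrite big_cons scalerAr hornerM hornerXsubC.
apply: multiplier_sequenceM.
  by apply: multiplier_sequence_shift; rewrite oppr_gt0 sN// mem_head.
by apply: IH => t ts; apply: sN; rewrite inE ts orbT.
Qed.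

(** Off the real axis L W - W' = W (L - sum_r 1 / (z - r)), and the sum is not
    real unless it is empty, in which case L remains. *)
Lemma only_real_zeros_sub_deriv (R : realType) (L : R) (s : seq R) :
  let W := \prod_(r <- s) ('X - r%:P) in
  L != 0 -> only_real_zeros (L *: W - W^`()).
Proof.
move=> W L0; apply: only_real_zerosI => z z0.
rewrite rmorphB /= map_polyZ hornerD hornerN hornerZ /=.
have W0 := horner_prod_real_neq0 s (oner_neq0 R) z0.
have := horner_deriv_prod_real 1 s z0.
rewrite scale1r -/W in W0 *; move=> ->.
rewrite mulrC -mulrBr mulf_neq0// {W W0}; case: s => [|r s].
  by rewrite big_nil subr0 fmorph_eq0.
have h := @Im_partial_fraction R [seq (1, r) | r <- r :: s] z z0.
rewrite subr_eq0; apply/eqP => LE; move: h.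
rewrite big_map; under eq_bigr do rewrite mul1r.
rewrite -LE mulr0 ltxx => h.
suff : false by []; apply: h => // w /mapP[t _ ->]; exact: ltr01.
Qed.

Lemma ln_le_harmonic (R : realType) n : ln n.+1%:R <= series (@harmonic R) n.
Proof.
elim: n => [|n IH]; first by rewrite ln1 /series /= big_geq.
rewrite seriesSr -lerBlDl; apply: le_trans (lerB (lexx _) IH) _.
rewrite -ln_div ?posrE//.
rewrite (_ : _ / _ = 1 + harmonic n :> R); last first.
  by rewrite /harmonic/= -[n.+2]addn1 natrD mulrDl divff// mul1r.
by apply: le_ln1Dx; apply: lt_le_trans (harmonic_ge0 n); rewrite oppr_lt0.
Qed.

(** By 1/(n+1) <= ln((n+1)/n) <= 1/n, the sequence H_n - ln n is decreasing
    and nonnegative, so that it converges, to a limit which is at most its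
    value 1 at n = 1. *)
Lemma euler_mascheroni_le1 (R : realType) : euler_mascheroni R <= 1.
Proof.
pose u n : R := series harmonic n.+1 - ln n.+1%:R.
have uS n : u n.+1 <= u n.
  suff h : harmonic n.+1 <= ln n.+2%:R - ln n.+1%:R :> R.
    by rewrite /u seriesSr; lra.
  rewrite -lerN2 opprB -ln_div ?posrE//.
  rewrite (_ : _ / _ = 1 - harmonic n.+1 :> R); last first.
    rewrite /harmonic/= -[n.+2 in RHS]addn1 natrD.
    by field; rewrite nat1r natr1 pnatr_eq0.
  apply: le_ln1Dx; rewrite ltrN2 /harmonic/= invf_lt1// ltr1n//.
have u_cvg : cvgn u.
  apply: nonincreasing_is_cvgn; first exact/nonincreasing_seqP.
  exists 0 => _ [n _ <-]; rewrite subr_ge0.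
  apply: le_trans (ln_le_harmonic R n) _.
  by rewrite seriesSr lerDl harmonic_ge0.
have <- : limn u = euler_mascheroni R.
  apply/esym/cvg_lim => //.
  rewrite -[X in X @ _ --> _]/(fun n => series harmonic n - ln n%:R).
  by rewrite -cvg_shiftS.
apply: limr_le => //; apply: nearW => n.
elim: n => [|n]; last exact: le_trans.
by rewrite /u ln1 subr0 seriesSr /series/= big_geq// add0r /harmonic/= invr1.
Qed.

(** The left side is crude: H_2 - gamma >= 3/2 - 1. It gives positivity of the
    sequence and, with the increments 1/(n+3) of H_(n+2), its growth bound. *)
Lemma harmonic_sub_euler_ge (R : realType) n :
  2^-1 <= series harmonic n.+2 - euler_mascheroni R.
Proof.
have g1 := euler_mascheroni_le1 R.
elim: n => [|n IH].
  by rewrite !seriesSr /series/= big_geq// add0r /harmonic/= invr1; lra.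
by rewrite seriesSr addrAC (le_trans IH)// lerDl harmonic_ge0.
Qed.

Lemma gamma_seq_gt0 (R : realType) n : 0 < gamma_seq R n.
Proof.
rewrite divr_gt0 ?ltr0n ?fact_gt0//.
by apply: lt_le_trans (harmonic_sub_euler_ge R n); rewrite invr_gt0.
Qed.

(** Each increment of H_(n+2) - gamma is at most 1/3, less than the value at n
    = 0, so this difference at most doubles from n to n + 1. *)
Lemma gamma_seq_growth (R : realType) n :
  gamma_seq R n * n`!%:R <= gamma_seq R 0 * 2 ^+ n.
Proof.
rewrite /gamma_seq divfK ?pnatr_eq0 -?lt0n ?fact_gt0// fact0 divr1.
have h0 := harmonic_sub_euler_ge R 0.
set h := _ - _ in h0 *.
elim: n => [|n IH]; first by rewrite expr0 mulr1.
rewrite seriesSr addrAC exprS mulrCA mulrDl mul1r lerD//.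
apply: (@le_trans _ _ 2^-1).
  by rewrite /harmonic/= lef_pV2 ?posrE// ler_nat.
apply: (le_trans h0); rewrite ler_peMr ?exprn_ege1 ?ler1n//.
by apply: le_trans h0; rewrite invr_ge0.
Qed.

(** The zeros -3, ..., -(N+2) are the first N poles of psi(s+3), so W'/W is
    the truncation of the partial fraction series of psi. *)
Definition rising_poly (R : realType) (N : nat) : {poly R} :=
  \prod_(r <- [seq - i.+3%:R | i <- iota 0 N]) ('X - r%:P).

(** The value of W'/W at an integer n. *)
Lemma sum_inv_poles_harmonic (R : realType) (n N : nat) :
  \sum_(r <- [seq - i.+3%:R | i <- iota 0 N]) (n%:R - r)^-1 =
  series harmonic (n + N.+2)%N - series harmonic n.+2 :> R.
Proof.
rewrite big_map; elim: N => [|N IH]; first by rewrite big_nil addn2 subrr.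
rewrite -[in LHS]addn1 iotaD big_cat big_seq1 /= IH add0n opprK -natrD.
by rewrite addrAC !addnS [in X in _ = X - _]seriesSr.
Qed.

Lemma notin_neg_natr (R : realType) (N : nat) (x : R) :
  0 <= x -> x \notin [seq - i.+3%:R | i <- iota 0 N].
Proof.
move=> x0; apply/mapP => -[i _ xE]; move: x0.
by rewrite xE oppr_ge0 leNgt ltr0n.
Qed.

Lemma horner_rising_poly (R : realType) (n N : nat) :
  (rising_poly R N).[n%:R] * (n.+2)`!%:R = (n + N.+2)`!%:R.
Proof.
rewrite /rising_poly big_map; elim: N => [|N IH].
  by rewrite big_nil hornerC mul1r addn2.
rewrite -addn1 iotaD big_cat big_seq1 /= hornerM hornerXsubC add0n.
rewrite mulrAC IH opprK -natrD addn1 -natrM mulnC.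
by rewrite [in RHS]addnS factS addnS.
Qed.

Lemma harmonic_gap_cvg (R : realType) (n : nat) :
  series harmonic (n + N.+2)%N - series harmonic N.+2 @[N --> \oo] --> (0 : R).
Proof.
elim: n => [|n IH]; first by under eq_cvg do rewrite subrr; exact: cvg_cst.
rewrite (_ : (fun N => _) = fun N => (series harmonic (n + N.+2)%N -
    series harmonic N.+2) + harmonic (N + n.+2)%N); last first.
  by apply/funext => N; rewrite addSn seriesSr addrAC !addnS addnC.
have h : harmonic (N + n.+2)%N @[N --> \oo] --> (0 : R).
  by have := @cvg_harmonic R; rewrite -(cvg_shiftn n.+2).
by have := cvgD IH h; rewrite addr0; apply.
Qed.

(** The quotient is n! times the approximant of 1 / Gamma(n+1) in the Euler
    limit formula, truncated after N + 2 factors. *)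
Lemma factorial_ratio_cvg (R : realType) (n : nat) :
  (n + N.+2)`!%:R / (N.+2`!%:R * N.+2%:R ^+ n) @[N --> \oo] --> (1 : R).
Proof.
have f0 m : m`!%:R != 0 :> R by rewrite pnatr_eq0 -lt0n fact_gt0.
elim: n => [|n IH].
  by under eq_cvg do rewrite expr0 mulr1 divff//; exact: cvg_cst.
rewrite (_ : (fun N => _) = fun N => (1 + n.+1%:R * harmonic N.+1) *
    ((n + N.+2)`!%:R / (N.+2`!%:R * N.+2%:R ^+ n))); last first.
  apply/funext => N; rewrite addSn factS natrM -addSn natrD exprS /harmonic/=.
  by field; rewrite f0 expf_neq0 ?pnatr_eq0// -natrD pnatr_eq0.
have h0 : harmonic N.+1 @[N --> \oo] --> (0 : R).
  by have := @cvg_harmonic R; rewrite -cvg_shiftS.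
have h1 : 1 + n.+1%:R * harmonic N.+1 @[N --> \oo] --> (1 : R).
  have := cvgD (cvg_cst (1 : R)) (cvgMl_tmp (a := n.+1%:R) h0).
  by rewrite mulr0 addr0; apply.
by have := cvgM h1 IH; rewrite mulr1; apply.
Qed.

(** Here G N is the restriction to the integers of
    Phi_N(s) = (s+1) (s+2) (L W - W')(s) / ((N+2)! (N+2)^s). The factors s + 1
    and s + 2 account for the zeros of 1/Gamma(s+1) that are not poles of
    psi(s+3), and W for the first N of those that are. *)
Lemma gamma_seq_multiplier (R : realType) : multiplier_sequence (gamma_seq R).
Proof.
pose L N : R := series harmonic N.+2 - euler_mascheroni R.
have L0 N : 0 < L N.
  by rewrite (lt_le_trans _ (harmonic_sub_euler_ge R N)) ?invr_gt0.
pose Q N : {poly R} := L N *: rising_poly R N - (rising_poly R N)^`().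
have QR N : only_real_zeros (Q N).
  by apply: only_real_zeros_sub_deriv; rewrite gt_eqF.
have QE N (x : R) : 0 <= x -> (Q N).[x] = (rising_poly R N).[x] *
    (L N - \sum_(r <- [seq - i.+3%:R | i <- iota 0 N]) (x - r)^-1).
  move=> x0; rewrite hornerD hornerN hornerZ.
  by rewrite horner_deriv_prod_XsubC ?notin_neg_natr// mulrBr mulrC.
have Qn0 N (x : R) : 0 <= x -> (Q N).[x] != 0.
  move=> x0; rewrite QE// mulf_neq0//.
    by have := notin_neg_natr N x0; rewrite -root_prod_XsubC.
  rewrite gt_eqF// subr_gt0.
  (* The sum is largest at x = 0, where it equals H_(N+2) - H_2. *)
  apply: (@le_lt_trans _ _ (L N - L 0%N)); last by rewrite ltrBlDr ltrDl.
  rewrite /L opprB addrA subrK -[N.+2]add0n -sum_inv_poles_harmonic !big_map.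
  apply: ler_sum => i _.
  by rewrite !opprK lef_pV2 ?posrE ?add0r ?lerDr// ltr_wpDl.
pose G N k := (N.+2`!%:R^-1 * N.+2%:R^-1 ^+ k) *
   ((k%:R + 1) * ((k%:R + 2) * (Q N).[k%:R])).
apply: (@multiplier_sequence_lim _ G) => [N|k|k].
- apply: multiplier_sequenceM.
    apply: multiplier_sequence_exp; rewrite invr_eq0 pnatr_eq0//.
    by rewrite -lt0n fact_gt0.
  apply: multiplier_sequenceM; first exact: multiplier_sequence_shift.
  apply: multiplier_sequenceM; first exact: multiplier_sequence_shift.
  by apply: multiplier_sequence_horner; [exact: QR|exact: Qn0].
- have GE N : G N k = ((k + N.+2)`!%:R / (N.+2`!%:R * N.+2%:R ^+ k)) *
     (L k - (series harmonic (k + N.+2)%N - series harmonic N.+2)) / k`!%:R.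
    rewrite /G QE// sum_inv_poles_harmonic -horner_rising_poly.
    rewrite exprVn !factS !natrM.
    have f0 m : m`!%:R != 0 :> R by rewrite pnatr_eq0 -lt0n fact_gt0.
    rewrite /L -[k.+2]addn2 -[k.+1]addn1 !natrD.
    by field; rewrite !f0 expf_neq0 ?pnatr_eq0// nat1r -natrD !pnatr_eq0.
  rewrite (funext GE).
  apply: cvgMr_tmp.
  have gap : L k - (series harmonic (k + N.+2)%N - series harmonic N.+2)
      @[N --> \oo] --> L k.
    have := cvgB (cvg_cst (L k)) (@harmonic_gap_cvg R k).
    by rewrite subr0; apply.
  by have := cvgM (@factorial_ratio_cvg R k) gap; rewrite mul1r; apply.
- by rewrite mulf_neq0 ?invr_eq0 ?pnatr_eq0 -?lt0n ?fact_gt0// gt_eqF// L0.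
Qed.

(** * Finite products of factors 1 + a_i *)

(** Induction on n: multiplying both sides by 1 + a_n changes the difference
    by a_n times the partial product, whose modulus is at most prod (1 +
    |a_i|). *)
Lemma normr_prod1D_sub (K : numDomainType) (a : nat -> K) m n :
  (m <= n)%N ->
  `|\prod_(0 <= i < n) (1 + a i) - \prod_(0 <= i < m) (1 + a i)| <=
    (\prod_(0 <= i < n) (1 + `|a i|)) * \sum_(m <= i < n) `|a i|.
Proof.
move=> /subnKC <-; elim: (n - m)%N => [|j IH].
  by rewrite addn0 subrr normr0 [X in _ * X]big_geq ?leqnn// mulr0.
have P0 : 0 <= \prod_(0 <= i < m + j) (1 + `|a i|).
  by apply: prodr_ge0 => i _; rewrite addr_ge0.
have PP : `|\prod_(0 <= i < m + j) (1 + a i)| <=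
    \prod_(0 <= i < m + j) (1 + `|a i|).
  rewrite normr_prod; apply: ler_prod => i _.
  by rewrite normr_ge0 /= (le_trans (ler_normD _ _))// normr1.
rewrite addnS !big_nat_recr ?leq_addr//=.
rewrite mulrDr mulr1 addrAC; apply: le_trans (ler_normD _ _) _.
apply: le_trans (lerD IH _) _.
  by rewrite normrM; apply: ler_wpM2r (PP).
rewrite -mulrDr ler_wpM2r//; last by rewrite mulrDr mulr1 lerDl mulr_ge0.
by rewrite addr_ge0// sumr_ge0.
Qed.

Lemma prod1D_le_expR (R : realType) (b : nat -> R) n :
  (forall i, 0 <= b i) ->
  \prod_(0 <= i < n) (1 + b i) <= expR (\sum_(0 <= i < n) b i).
Proof.
move=> b0; rewrite expR_sum; apply: ler_prod => i _.
by rewrite addr_ge0//= expR_ge1Dx.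
Qed.

Definition prod1DX (R : realType) (s : seq R) : {poly R} :=
  \prod_(t <- s) (1 + t *: 'X).

Lemma prod1DX_cons (R : realType) (t : R) s :
  prod1DX (t :: s) = prod1DX s + t *: ('X * prod1DX s).
Proof. by rewrite /prod1DX big_cons mulrDl mul1r -scalerAl. Qed.

Lemma nth_ge0 (R : numDomainType) (s : seq R) i :
  {in s, forall t, 0 <= t} -> 0 <= nth 0 s i.
Proof.
move=> s0; have [si|si] := ltnP i (size s); first exact/s0/mem_nth.
by rewrite nth_default.
Qed.

(** The coefficient is an elementary symmetric function of the nonnegative
    entries of s, and the product of the first k entries is one of its terms.
    Reading past the end of s gives the default value 0, for which the bound
    is trivial. *)
Lemma coef_prod1DX_ge (R : realType) (s : seq R) k :
  {in s, forall t, 0 <= t} ->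
  \prod_(0 <= i < k) nth 0 s i <= (prod1DX s)`_k.
Proof.
elim: s k => [|t s IH] k s0.
  rewrite /prod1DX big_nil coef1; case: k => [|k]; first by rewrite big_geq.
  by rewrite big_nat_recl//= mul0r.
have t0 : 0 <= t by apply: s0; rewrite mem_head.
have {}s0 : {in s, forall t, 0 <= t}.
  by move=> u us; apply: s0; rewrite inE us orbT.
rewrite prod1DX_cons coefD coefZ coefXM.
case: k => [|k] /=.
  by rewrite mulr0 addr0 (le_trans _ (IH 0%N s0))// !big_geq.
rewrite big_nat_recl//=; apply: le_trans (ler_wpM2l t0 (IH k s0)) _.
rewrite lerDr; apply: le_trans (IH k.+1 s0); apply: prodr_ge0 => i _.
exact: nth_ge0.
Qed.

Lemma expr_nth_le_prod (R : realType) (s : seq R) k :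
  sorted >=%O s -> {in s, forall t, 0 <= t} ->
  nth 0 s k ^+ k.+1 <= \prod_(0 <= i < k.+1) nth 0 s i.
Proof.
move=> ss s0.
have [ks|ks] := ltnP k (size s); last first.
  by rewrite nth_default// expr0n prodr_ge0// => i _; exact: nth_ge0.
rewrite -[X in _ ^+ X]subn0 -prodr_const_nat big_nat [leRHS]big_nat.
apply: ler_prod => i /= ik; rewrite nth_ge0//=.
apply: (sorted_leq_nth _ _ _ ss) => //.
- by move=> x y z /= xy yz; exact: le_trans yz xy.
- by move=> x /=.
- by rewrite inE (leq_ltn_trans _ ks).
Qed.

(** The roots r are negative since the coefficients are nonnegative and the
    constant one is positive; the entries of s are the -1/r in decreasing
    order. *)
Lemma real_zeros_prod1DX (R : realType) (f : {poly R}) :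
  only_real_zeros f -> 0 < f`_0 -> (forall k, 0 <= f`_k) ->
  exists s : seq R, [/\ sorted >=%O s, {in s, forall t, 0 <= t} &
    f = f`_0 *: prod1DX s].
Proof.
move=> fR f0 fk.
have fn0 : f != 0 by apply: contraTneq f0 => ->; rewrite coef0 ltxx.
have [s sE] := real_zeros_split fn0 fR.
have sN r : r \in s -> r < 0.
  move=> rs; have : root f r.
    by rewrite sE rootZ ?lead_coef_eq0// root_prod_XsubC.
  apply: contraTT; rewrite -leNgt => r0; rewrite /root gt_eqF//.
  apply: (lt_le_trans f0); rewrite horner_coef.
  case: (size f) (size_poly_gt0 f) => [|n _]; first by rewrite fn0.
  rewrite big_ord_recl expr0 mulr1 lerDl sumr_ge0// => i _.
  by rewrite mulr_ge0// exprn_ge0.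
pose s' := sort >=%O [seq - r^-1 | r <- s].
have s'E : exists c, f = c *: prod1DX s'.
  rewrite /prod1DX (perm_big _ (permEl (perm_sort _ _))) big_map sE.
  elim: s sN (lead_coef _) {s' sE} => [|r s IH] sN c.
    by exists c; rewrite !big_nil.
  have r0 : r < 0 by apply: sN; rewrite mem_head.
  have [t ts|d dE] := IH _ (c * - r); first by apply: sN; rewrite inE ts orbT.
  exists d; rewrite !big_cons [in RHS]scalerAr -dE -[in RHS]scalerAr.
  rewrite -scalerA; congr (_ *: _); rewrite scalerAl; congr (_ * _).
  rewrite scalerDr scalerA mulrNN divff ?lt_eqF//.
  by rewrite scale1r addrC -mul_polyC mulr1 polyCN.
have [c cE] := s'E.
have s'0 : {in s', forall t, 0 <= t}.
  move=> t; rewrite mem_sort => /mapP[r rs ->].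
  by rewrite oppr_ge0 invr_le0 ltW// sN.
exists s'; split => //.
  apply: sort_sorted => x y; exact: le_total.
have c0 : f`_0 = c.
  rewrite cE coefZ; suff -> : (prod1DX s')`_0 = 1 by rewrite mulr1.
  elim: (s') => [|t u IH]; first by rewrite /prod1DX big_nil coef1.
  by rewrite prod1DX_cons coefD coefZ coefXM mulr0 addr0.
by rewrite c0.
Qed.

(** * Factorial estimates *)

(** A Stirling-type bound: x^m / m! is one term of the exponential series of
    x, taken at x = m. *)
Lemma expn_le_fact_expR (R : realType) (m : nat) :
  m.+1%:R ^+ m.+1 <= expR 1 ^+ m.+1 * m.+1`!%:R :> R.
Proof.
rewrite -expRM_natr mul1r -ler_pdivrMr ?ltr0n ?fact_gt0//.
by apply: le_trans (expR_ge1Dxn m (ler0n R m.+1)); rewrite lerDr.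
Qed.

Lemma ffact_ratio_le1 (R : realType) n k :
  (n.+1 ^_ k)%:R / n.+1%:R ^+ k <= 1 :> R.
Proof.
rewrite ler_pdivrMr ?exprn_gt0// mul1r -natrX ler_nat.
elim: k => // k IH; rewrite ffactnSr expnSr leq_mul// leq_subr//.
Qed.

(** The ratio is prod_(j < k) (1 - j / (n+1)) for k <= n + 1, and the sum of
    the j is at most k^2. For k > n + 1 the left side is negative. *)
Lemma ffact_ratio_ge (R : realType) n k :
  1 - k%:R ^+ 2 / n.+1%:R <= (n.+1 ^_ k)%:R / n.+1%:R ^+ k :> R.
Proof.
elim: k => [|k IH]; first by rewrite expr0n mul0r subr0 ffactn0 expr0 divr1.
have n0 : 0 < n.+1%:R :> R by [].
set t := (n.+1 ^_ k)%:R / _ in IH *.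
have t1 : t <= 1 := ffact_ratio_le1 R n k.
have t0 : 0 <= t by rewrite divr_ge0// exprn_ge0.
have -> : (n.+1 ^_ k.+1)%:R / n.+1%:R ^+ k.+1 =
    t * ((n.+1 - k)%:R / n.+1%:R) :> R.
  rewrite /t ffactnSr natrM exprSr; field.
  by rewrite nat1r expf_neq0// gt_eqF.
have h : 1 - k%:R / n.+1%:R <= (n.+1 - k)%:R / n.+1%:R :> R.
  rewrite (_ : 1 - _ = (n.+1%:R - k%:R) / n.+1%:R); last first.
    by rewrite mulrBl divff ?gt_eqF.
  rewrite ler_pM2r ?invr_gt0//.
  have [kn|kn] := leqP k n.+1; first by rewrite natrB.
  by rewrite (eqP (ltnW kn)) subr_le0 ler_nat ltnW.
apply: le_trans (ler_wpM2l t0 h).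
set x := k%:R / n.+1%:R in h *.
have x0 : 0 <= x by rewrite divr_ge0.
have -> : k.+1%:R ^+ 2 / n.+1%:R =
    k%:R ^+ 2 / n.+1%:R + 2 * x + n.+1%:R^-1 :> R.
  rewrite /x -natr1; ring.
have tx : t * x <= x by rewrite ler_piMl.
have n'0 : 0 <= n.+1%:R^-1 :> R by rewrite invr_ge0.
move: (k%:R ^+ 2 / n.+1%:R : R) (n.+1%:R^-1 : R) IH n'0 => q w IH w0.
by rewrite mulrBr mulr1; clear h; lra.
Qed.

(** * Convergence of complex sequences *)

(** The topology of the complex numbers is defined by positive complex radii,
    which are real; this restates convergence with real radii. *)
Lemma cvgCP (R : realType) (T : Type) (F : set_system T) (FF : Filter F)
    (u : T -> Cplx R) (l : Cplx R) :
  u @ F --> l <-> forall e : R, 0 < e -> \forall t \near F, modC (l - u t) <= e.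
Proof.
split=> [/cvgrPdist_le ul e e0|ul].
  have eC : 0 < e%:C :> Cplx R by rewrite ltcR.
  by have := ul _ eC; apply: filterS => t; rewrite modCE lecR.
apply/cvgrPdist_le => -[a b]; rewrite ltcE /= => /andP[/eqP -> a0].
by have := ul _ a0; apply: filterS => t; rewrite modCE -lecR.
Qed.

Lemma cvgC_real (R : realType) (T : Type) (F : set_system T) (FF : Filter F)
    (u : T -> R) (l : R) :
  u @ F --> l -> ((u x)%:C : Cplx R) @[x --> F] --> (l%:C : Cplx R).
Proof.
move=> /cvgrPdist_le ul; apply/cvgCP => e /ul; apply: filterS => t.
by rewrite -rmorphB modC_real.
Qed.

Lemma cvgC_ReIm (R : realType) (u : nat -> Cplx R) (a b : R) :
  complex.Re (u n) @[n --> \oo] --> a -> complex.Im (u n) @[n --> \oo] --> b ->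
  u @ \oo --> (a +i* b : Cplx R).
Proof.
move=> /cvgrPdist_le ua /cvgrPdist_le ub; apply/cvgCP => e e0.
have e20 : 0 < e / 2 by rewrite divr_gt0.
near=> n; apply: le_trans (modC_le_ReIm _) _.
rewrite [e]splitr lerD//.
  rewrite (_ : complex.Re _ = a - complex.Re (u n)); last by case: (u n).
  by near: n; exact: ua.
rewrite (_ : complex.Im _ = b - complex.Im (u n)); last by case: (u n).
by near: n; exact: ub.
Unshelve. all: by end_near. Qed.

(** Completeness of R[i] is obtained from that of R, on real and imaginary
    parts. *)
Lemma cvg_series_modC (R : realType) (u : nat -> Cplx R) (v : nat -> R) :
  (forall k, modC (u k) <= v k) -> cvgn (series v) -> cvgn (series u).
Proof.
move=> uv vcvg.
have v0 k : 0 <= v k by apply: le_trans (modC_ge0 _) (uv k).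
have cvg_part (p : Cplx R -> R) : {morph p : x y / x + y} -> p 0 = 0 ->
    (forall x, `|p x| <= modC x) -> cvgn (p \o series u).
  move=> pD p0 pm.
  rewrite (_ : p \o series u = series (p \o u)); last first.
    by apply/funext => n; rewrite /series /= (big_morph p pD p0).
  apply: normed_cvg; apply: (@series_le_cvg _ (fun k => `|p (u k)|) v) => // k.
  exact: le_trans (pm _) (uv k).
have /cvg_ex[a ua] : cvgn (@complex.Re R \o series u).
  apply: cvg_part => // [[? ?] [? ?]//|x].
  by rewrite -lecR -modCE normc_ge_Re.
have /cvg_ex[b ub] : cvgn (@complex.Im R \o series u).
  apply: cvg_part => // [[? ?] [? ?]//|x].
  by rewrite -lecR -modCE normIm_le.
by apply/cvg_ex; exists (a +i* b : Cplx R); exact: cvgC_ReIm.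
Qed.

(** A cluster point of an ultrafilter is a limit of it, and bounded sequences
    have cluster points. *)
Lemma ultra_bounded_cvg (R : realType) (U : set_system nat)
    (UU : UltraFilter U) (u : nat -> R) (a b : R) :
  (forall n, a <= u n <= b) -> exists l : R, u @ U --> l.
Proof.
move=> uab.
have UF : ProperFilter (u @ U) by exact: fmap_proper_filter.
have [|l [_ ul]] := @segment_compact R a b (u @ U) UF.
  by apply: (@filterE nat U) => n /=; rewrite in_itv /=; exact: uab.
exists l => V /= Vl.
have [//|nV] := in_ultra_setVsetC (u @^-1` V) UU.
have [x [nVx Vx]] := ul (~` V) V nV Vl.
by case: nVx.
Qed.

(** Comparison with the telescoping series of 1 / (i (i+1)). *)
Lemma sum_invr_sqr_le (R : realType) m n : (m <= n)%N ->
  \sum_(m.+1 <= i < n.+1) (i.+1%:R ^+ 2)^-1 <= m.+1%:R^-1 :> R.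
Proof.
move=> mn; apply: (@le_trans _ _ (m.+1%:R^-1 - n.+1%:R^-1)); last first.
  by rewrite lerBlDr lerDl invr_ge0.
have <- : \sum_(m.+1 <= i < n.+1) (- i.+1%:R^-1 - - i%:R^-1) =
    m.+1%:R^-1 - n.+1%:R^-1 :> R.
  by rewrite (telescope_sumr (fun i => - i%:R^-1)) ?ltnS// opprK addrC.
apply: ler_sum_nat => i /andP[mi _].
have i0 : 0 < i%:R :> R by rewrite ltr0n (leq_trans _ mi).
have i10 : 0 < i.+1%:R :> R by [].
have -> : - i.+1%:R^-1 - - i%:R^-1 = (i.+1%:R ^+ 2)^-1 +
    (i.+1%:R ^+ 2 * i%:R)^-1 :> R.
  by rewrite -natr1; field; rewrite natr1 !gt_eqF.
by rewrite lerDl invr_ge0 mulr_ge0// ?exprn_ge0// ltW.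
Qed.

(** * The approximating polynomials *)

(** As (1 + X / (n+1))^(n+1) tends to exp X, these polynomials tend to the
    exponential generating function of g. *)
Definition jensen_poly (R : realType) (g : nat -> R) (n : nat) : {poly R} :=
  diag_op g ((1 + n.+1%:R^-1 *: 'X) ^+ n.+1).

Lemma coef_jensen_poly (R : realType) (g : nat -> R) n k :
  (jensen_poly g n)`_k = g k / k`!%:R * ((n.+1 ^_ k)%:R / n.+1%:R ^+ k).
Proof.
rewrite /jensen_poly; have -> : (1 + n.+1%:R^-1 *: 'X) ^+ n.+1 =
    \poly_(i < n.+2) (n.+1%:R^-1 ^+ i * 'C(n.+1, i)%:R) :> {poly R}.
  rewrite exprDn poly_def; apply: eq_bigr => i _.
  by rewrite expr1n mul1r exprZn -scaler_nat scalerA mulrC.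
rewrite coef_diag_op coef_poly.
have k0 : k`!%:R != 0 :> R by rewrite pnatr_eq0 -lt0n fact_gt0.
case: ltnP => [_|nk]; last by rewrite ffact_small// !mul0r !mulr0.
rewrite -bin_ffact natrM exprVn; field.
by rewrite k0 expf_neq0// nat1r pnatr_eq0.
Qed.

Lemma jensen_poly_real_zeros (R : realType) (g : nat -> R) n :
  multiplier_sequence g -> only_real_zeros (jensen_poly g n).
Proof.
apply; apply: only_real_zerosI => z z0.
rewrite rmorphXn /= horner_exp expf_neq0// rmorphD /= map_polyZ /= map_polyX.
rewrite rmorph1 hornerD hornerC hornerZ hornerX.
apply: contraNneq z0 => /eqP; rewrite addr_eq0 => /eqP zE.
have e : (n.+1%:R^-1)%:C * z = -1 by apply: oppr_inj; rewrite -zE opprK.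
have -> : z = (- n.+1%:R)%:C.
  apply: (@mulfI _ (n.+1%:R^-1)%:C).
    by rewrite fmorph_eq0 invr_eq0 pnatr_eq0.
  by rewrite e -rmorphM mulrN mulVf ?pnatr_eq0// rmorphN1.
by [].
Qed.

Lemma growth_base_ge0 (R : realType) (g : nat -> R) (B : R) :
  (forall k, 0 < g k) -> (forall k, g k * k`!%:R <= g 0%N * B ^+ k) -> 0 <= B.
Proof.
move=> g0 gB; have := gB 1%N; rewrite expr1 mulr1 => gB1.
by rewrite -(pmulr_rge0 _ (g0 0%N)) (le_trans _ gB1)// ltW.
Qed.

Lemma growth_le (R : realType) (g : nat -> R) (B : R) k :
  (forall k, 0 < g k) -> (forall k, g k * k`!%:R <= g 0%N * B ^+ k) ->
  g k <= g 0%N * B ^+ k.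
Proof.
move=> g0 gB; apply: le_trans (gB k); rewrite ler_peMr ?(ltW (g0 _))//.
by rewrite ler1n fact_gt0.
Qed.

(** With m = i + 1, monotonicity gives y_i^m <= y_0 ... y_i, which is at most
    the coefficient of X^m in f_n / g_0, hence at most B^m / m!^2 <= (B e^2 /
    m^2)^m. Zero entries are appended to the finitely many y_i, which is why
    the identity holds for all large M. *)
Lemma jensen_poly_factors (R : realType) (g : nat -> R) (B : R) n :
  (forall k, 0 < g k) -> (forall k, g k * k`!%:R <= g 0%N * B ^+ k) ->
  multiplier_sequence g ->
  exists y : nat -> R, [/\ forall i, 0 <= y i,
    forall i, y i <= B * expR 1 ^+ 2 / i.+1%:R ^+ 2,
    forall i, y i.+1 <= y i &
    exists M0, forall M (z : Cplx R), (M0 <= M)%N ->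
      (map_poly (real_complex R) (jensen_poly g n)).[z] =
      (g 0%N)%:C * \prod_(0 <= i < M) (1 + (y i)%:C * z)].
Proof.
move=> g0 gB gM.
have c0 : (jensen_poly g n)`_0 = g 0%N.
  by rewrite coef_jensen_poly ffactn0 expr0 fact0 !divr1 mulr1.
have B0 := growth_base_ge0 g0 gB.
have [||s [ss s0 sE]] := real_zeros_prod1DX (jensen_poly_real_zeros n gM).
- by rewrite c0.
- by move=> k; rewrite coef_jensen_poly mulr_ge0// divr_ge0// ?exprn_ge0// ltW.
exists (nth 0 s); split => [i|i|i|]; first exact: nth_ge0.
- have f0 : 0 < i.+1`!%:R :> R by rewrite ltr0n fact_gt0.
  rewrite -(@ler_pXn2r _ i.+1) ?nnegrE ?nth_ge0 ?divr_ge0 ?mulr_ge0//;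
    rewrite ?exprn_ge0 ?expR_ge0//.
  apply: le_trans (expr_nth_le_prod i ss s0) _.
  apply: le_trans (coef_prod1DX_ge i.+1 s0) _.
  have e : g i.+1 / i.+1`!%:R * ((n.+1 ^_ i.+1)%:R / n.+1%:R ^+ i.+1) =
      g 0%N * (prod1DX s)`_i.+1.
    by rewrite -coef_jensen_poly {1}sE c0 coefZ.
  rewrite -(ler_pM2l (g0 0%N)) -e.
  apply: (@le_trans _ _ (g i.+1 / i.+1`!%:R)).
    by rewrite ler_piMr ?ffact_ratio_le1// divr_ge0// ltW.
  rewrite ler_pdivrMr//.
  have h := expn_le_fact_expR R i.
  have P0 : 0 < i.+1%:R ^+ i.+1 :> R by rewrite exprn_gt0.
  rewrite !exprMn exprVn -!exprM ![(2 * _)%N]mulnC !exprM.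
  set F := i.+1`!%:R in f0 h *; set P := i.+1%:R ^+ i.+1 in h P0 *.
  set X := expR 1 ^+ i.+1 in h *.
  rewrite -(ler_pM2r f0); apply: le_trans (gB i.+1) _.
  rewrite -!mulrA ler_pM2l// ler_peMr ?exprn_ge0//.
  rewrite (_ : X * _ = (X * F) ^+ 2 / P ^+ 2); last by ring.
  rewrite ler_pdivlMr ?exprn_gt0// mul1r.
  by rewrite ler_pXn2r// ?nnegrE ?ltW// (lt_le_trans P0).
- have [si|si] := ltnP i.+1 (size s); last first.
    by rewrite nth_default// nth_ge0.
  apply: (sorted_leq_nth _ _ _ ss) => //.
  + by move=> x y z /= xy yz; exact: le_trans yz xy.
  + by move=> x /=.
  + by rewrite inE ltnW.
- exists (size s) => M z sM.
  rewrite sE c0 map_polyZ hornerZ; congr (_ * _).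
  rewrite /prod1DX rmorph_prod horner_prod (big_nth 0).
  rewrite (big_cat_nat _ sM)//= [X in _ = _ * X]big_nat.
  rewrite [X in _ = _ * X]big1 ?mulr1.
    apply: eq_bigr => i _.
    rewrite rmorphD rmorph1 /= map_polyZ /= map_polyX.
    by rewrite hornerD hornerC hornerZ hornerX.
  by move=> i /andP[si _]; rewrite nth_default// mul0r addr0.
Qed.

Lemma series_exp_coeff_le_expR (R : realType) (x : R) M :
  0 <= x -> \sum_(0 <= k < M) x ^+ k / k`!%:R <= expR x.
Proof.
move=> x0; apply: (@nondecreasing_cvgn_le _ (series (exp_coeff x))).
  by apply: nondecreasing_series => k _ _; exact: exp_coeff_ge0.
exact: is_cvg_series_exp_coeff.
Qed.

Lemma real_entire_egf (R : realType) (g : nat -> R) (B : R) :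
  (forall k, 0 < g k) -> (forall k, g k * k`!%:R <= g 0%N * B ^+ k) ->
  real_entire g (egf g).
Proof.
move=> g0 gB z.
have B0 := growth_base_ge0 g0 gB.
apply: (@cvg_series_modC _ _ (fun k => g 0%N * exp_coeff (B * modC z) k)).
  move=> k; rewrite /egf_terms modCM modC_real modCX ger0_norm; last first.
    by rewrite divr_ge0// ltW.
  rewrite /exp_coeff /= exprMn !mulrA [leLHS]mulrAC.
  rewrite ler_pM2r ?invr_gt0 ?ltr0n ?fact_gt0//.
  rewrite ler_wpM2r ?exprn_ge0 ?modC_ge0//.
  exact: growth_le.
apply: is_cvg_seriesZ; exact: is_cvg_series_exp_coeff.
Qed.

(** The k-th coefficients differ by g_k / k! times 1 - (n+1)^_k / (n+1)^k, and
    this factor is at most k^2 / (n+1) <= 4^k / (n+1). With g_k <= g_0 B^k, the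
    sum over k is then dominated by an exponential series. *)
Lemma egf_jensen_dist (R : realType) (g : nat -> R) (B : R) n (z : Cplx R) :
  (forall k, 0 < g k) -> (forall k, g k * k`!%:R <= g 0%N * B ^+ k) ->
  modC (egf g z - (map_poly (real_complex R) (jensen_poly g n)).[z]) <=
    g 0%N * expR (4 * B * modC z) / n.+1%:R.
Proof.
move=> g0 gB.
have B0 := growth_base_ge0 g0 gB.
have partial M : (n.+1 < M)%N ->
    modC (series (egf_terms g z) M -
      (map_poly (real_complex R) (jensen_poly g n)).[z]) <=
    g 0%N * expR (4 * B * modC z) / n.+1%:R.
  move=> nM.
  rewrite (@horner_coef_wide _ M); last first.
    rewrite size_map_poly; apply/leq_sizeP => k Mk.
    by rewrite coef_jensen_poly ffact_small ?mul0r ?mulr0// (leq_trans nM).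
  rewrite /series /= big_mkord -sumrB -lecR -modCE.
  apply: le_trans (ler_norm_sum _ _ _) _.
  have r0 : 0 <= 4 * B * modC z by rewrite !mulr_ge0// modC_ge0.
  have := ler_wpM2l (ltW (g0 0%N)) (series_exp_coeff_le_expR M r0).
  move=> /(ler_wpM2r (_ : 0 <= n.+1%:R^-1)).
  rewrite invr_ge0 => /(_ (ler0n _ _)).
  rewrite -lecR; apply: le_trans.
  under eq_bigr do rewrite modCE.
  rewrite -(rmorph_sum (real_complex R)) lecR.
  rewrite big_mkord mulr_sumr mulr_suml; apply: ler_sum => k _.
  rewrite coef_map /= coef_jensen_poly /egf_terms -mulrBl -rmorphB.
  rewrite modCM modC_real modCX.
  rewrite -[X in X - _]mulr1 -mulrBr.
  have gk0 : 0 <= g k / k`!%:R by rewrite divr_ge0// ltW.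
  have t1 := ffact_ratio_le1 R n k.
  rewrite ger0_norm; last by rewrite mulr_ge0// subr_ge0.
  have t2 : 1 - (n.+1 ^_ k)%:R / n.+1%:R ^+ k <= 4 ^+ k / n.+1%:R :> R.
    rewrite lerBlDr -lerBlDl.
    apply: le_trans (ffact_ratio_ge R n k); rewrite lerB//.
    rewrite ler_pM2r ?invr_gt0// -!natrX ler_nat.
    rewrite (_ : 4 = 2 ^ 2)%N// -expnM mulnC expnM.
    by rewrite leq_exp2r// ltnW// ltn_expl.
  have t3 : g k / k`!%:R <= g 0%N * B ^+ k / k`!%:R.
    rewrite ler_pM2r ?invr_gt0 ?ltr0n ?fact_gt0//.
    exact: growth_le.
  rewrite (_ : _ / n.+1%:R = (g 0%N * B ^+ k / k`!%:R) *
      (4 ^+ k / n.+1%:R) * modC z ^+ k).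
    by rewrite ler_wpM2r ?exprn_ge0 ?modC_ge0// ler_pM// subr_ge0.
  rewrite !exprMn; ring.
apply/ler_addgt0Pr => e e0.
have /cvgCP/(_ e e0) := @real_entire_egf _ _ _ g0 gB z.
move=> /(filterI (nbhs_infty_gt n.+1)) /filter_ex[M [/= nM fM]].
apply: le_trans (ler_dist_modCD _ (series (egf_terms g z) M) _) _.
by rewrite addrC lerD// partial.
Qed.

(** * The canonical product *)

Lemma sum_quadratic_decay_le (R : realType) (y : nat -> R) (D : R) m n :
  (forall i, 0 <= y i) -> (forall i, y i <= D / i.+1%:R ^+ 2) -> (m <= n)%N ->
  \sum_(m.+1 <= i < n.+1) y i <= D / m.+1%:R.
Proof.
move=> y0 yD mn.
have D0 : 0 <= D by have := le_trans (y0 0%N) (yD 0%N); rewrite expr1n divr1.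
apply: le_trans (ler_wpM2l D0 (sum_invr_sqr_le R mn)).
by rewrite mulr_sumr; apply: ler_sum => i _.
Qed.

Lemma sum_quadratic_decay_le2 (R : realType) (y : nat -> R) (D : R) n :
  (forall i, 0 <= y i) -> (forall i, y i <= D / i.+1%:R ^+ 2) ->
  \sum_(0 <= i < n) y i <= D *+ 2.
Proof.
move=> y0 yD.
have D0 := yD 0%N; rewrite expr1n divr1 in D0.
apply: (@le_trans _ _ (\sum_(0 <= i < n.+1) y i)).
  by rewrite big_nat_recr//= lerDl.
rewrite big_ltn// mulr2n lerD//.
by apply: le_trans (sum_quadratic_decay_le y0 yD (leq0n n)) _; rewrite divr1.
Qed.

(** The bound does not depend on M, nor on y beyond the constant D of its
    quadratic decay. *)
Lemma prod_tail_le (R : realType) (y : nat -> R) (D : R) (z : Cplx R) K M :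
  (forall i, 0 <= y i) -> (forall i, y i <= D / i.+1%:R ^+ 2) -> (K < M)%N ->
  modC (\prod_(0 <= i < M) (1 + (y i)%:C * z) -
        \prod_(0 <= i < K.+1) (1 + (y i)%:C * z)) <=
    expR ((D *+ 2) * modC z) * (D / K.+1%:R * modC z).
Proof.
move=> y0 yD KM; rewrite -lecR -modCE.
have nE i : `|(y i)%:C * z| = (y i * modC z)%:C.
  by rewrite normrM normC_real (ger0_norm (y0 i)) modCE rmorphM.
apply: le_trans (normr_prod1D_sub _ KM) _.
under eq_bigr do rewrite nE -(rmorph1 (real_complex R)) -rmorphD.
under [X in _ * X]eq_bigr do rewrite nE.
rewrite -(rmorph_prod (real_complex R)) -(rmorph_sum (real_complex R)).
rewrite -rmorphM lecR.
have r0 := modC_ge0 z.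
apply: ler_pM.
- by apply: prodr_ge0 => i _; rewrite addr_ge0// mulr_ge0.
- by apply: sumr_ge0 => i _; rewrite mulr_ge0.
- apply: le_trans (prod1D_le_expR _ _) _; first by move=> i; rewrite mulr_ge0.
  by rewrite ler_expR -mulr_suml ler_wpM2r// sum_quadratic_decay_le2.
- rewrite -mulr_suml ler_wpM2r//; case: M KM => // M KM.
  exact: sum_quadratic_decay_le.
Qed.

(** An ultrafilter provides limits y_i of all the y_(n,i) at once, in place of
    a diagonal extraction of a subsequence. For fixed K, the distance from f
    to the partial product of length K + 1 is at most |f - f_n|, plus the tail
    of the product for f_n, plus the distance between the partial products for
    f_n and for the limit; the first and the last tend to 0 along the
    ultrafilter and the tail is O(1 / (K+1)). *)
Lemma egf_product (R : realType) (g : nat -> R) (B : R) :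
  (forall k, 0 < g k) -> (forall k, g k * k`!%:R <= g 0%N * B ^+ k) ->
  multiplier_sequence g ->
  exists y : nat -> R, [/\ forall i, 0 <= y i,
    forall i, y i <= B * expR 1 ^+ 2 / i.+1%:R ^+ 2,
    forall i, y i.+1 <= y i &
    forall z : Cplx R,
      (\prod_(0 <= i < n) (1 + (y i)%:C * z) : Cplx R) @[n --> \oo] -->
        (egf g z / (g 0%N)%:C : Cplx R)].
Proof.
move=> g0 gB gM.
have [Y YP] := choice (fun n => jensen_poly_factors n g0 gB gM).
set D := B * expR 1 ^+ 2 in YP *; clearbody D.
have Y0 n i : 0 <= Y n i by have [] := YP n.
have YD n i : Y n i <= D / i.+1%:R ^+ 2 by have [] := YP n.
have Yd n i : Y n i.+1 <= Y n i by have [] := YP n.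
have [U [UU sU]] := @ultraFilterLemma _ (\oo : set_system nat) _.
have [y yU] := choice (fun i => @ultra_bounded_cvg R U UU (Y^~ i) 0 _
  (fun n => introT andP (conj (Y0 n i) (YD n i)))).
have UF : ProperFilter U by exact: ultra_proper.
have y0 i : 0 <= y i.
  by apply: (cvgr_to_ge (yU i)); apply: (@filterE _ U) => n; exact: Y0.
have yD i : y i <= D / i.+1%:R ^+ 2.
  by apply: (cvgr_to_le (yU i)); apply: (@filterE _ U) => n; exact: YD.
have yd i : y i.+1 <= y i.
  apply: (ler_cvg_to (yU i.+1) (yU i)).
  by apply: (@filterE _ U) => n; exact: Yd.
exists y; split => // z.
pose f_ n : Cplx R := (map_poly (real_complex R) (jensen_poly g n)).[z].
pose P (v : nat -> R) K : Cplx R :=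
  (g 0%N)%:C * \prod_(0 <= i < K) (1 + (v i)%:C * z).
pose c := g 0%N * (expR ((D *+ 2) * modC z) * (D * modC z)).
have main K : modC (egf g z - P y K.+1) <= c * K.+1%:R^-1.
  apply/ler_addgt0Pr => e e0.
  have e20 : 0 < e / 2 by rewrite divr_gt0.
  have PU : P (Y n) K.+1 @[n --> U] --> P y K.+1.
    apply: cvgMl_tmp; apply: cvg_big => [|i _]; first exact: mul_continuous.
    apply: cvgD; first exact: cvg_cst.
    by apply: cvgMr_tmp; apply: cvgC_real; exact: yU.
  have /cvgCP/(_ _ e20) U1 := PU.
  have U2 : \forall n \near U, modC (egf g z - f_ n) <= e / 2.
    apply: sU; pose d := g 0%N * expR (4 * B * modC z).
    have : d * harmonic n @[n --> \oo] --> d * 0.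
      by apply: cvgMl_tmp; exact: cvg_harmonic.
    rewrite mulr0 => /cvgr_le/(_ _ e20); apply: filterS => n.
    exact: le_trans (egf_jensen_dist n z g0 gB).
  have [n [/= n1 n2]] := filter_ex (filterI U1 U2).
  have [_ _ _ [M0 YM]] := YP n.
  have M0M := leq_maxl M0 K.+1; have KM := leq_maxr M0 K.+1.
  set M := maxn _ _ in M0M KM.
  have tail := prod_tail_le z (Y0 n) (YD n) KM.
  have fP : modC (f_ n - P (Y n) K.+1) <= c * K.+1%:R^-1.
    rewrite /f_ /P (YM M z M0M) -mulrBr modCM modC_real.
    rewrite ger0_norm ?(ltW (g0 _))//.
    rewrite /c -!mulrA ler_wpM2l ?(ltW (g0 _))//; apply: le_trans tail _.
    by rewrite -[D / _ * _]mulrA [_^-1 * _]mulrC.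
  rewrite modCB in n1.
  have fy := le_trans (ler_dist_modCD _ _ _) (lerD fP n1).
  apply: le_trans (ler_dist_modCD _ (f_ n) _) (le_trans (lerD n2 fy) _).
  by rewrite addrCA -splitr.
rewrite -cvg_shiftS; apply/cvgCP => e e0.
have : (c / g 0%N) * harmonic n @[n --> \oo] --> (c / g 0%N) * 0.
  by apply: cvgMl_tmp; exact: cvg_harmonic.
rewrite mulr0 => /cvgr_le/(_ _ e0); apply: filterS => K; apply: le_trans.
rewrite -(ler_pM2l (g0 0%N)).
have g0n : g 0%N != 0 by rewrite gt_eqF.
rewrite [leRHS](_ : _ = c * K.+1%:R^-1); last first.
  by rewrite mulrA [_ * (c / _)]mulrC divfK.
apply: le_trans (main K); rewrite -[X in X * modC _](ger0_norm (ltW (g0 0%N))).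
by rewrite -modC_real -modCM mulrBr mulrC divfK// fmorph_eq0.
Qed.

(** Up to the factor g_0, the function equals prod_i (1 + y_i z) with y
    decreasing. The zeros -1 / y_i are indexed by the i with y_i > 0, which
    form an initial segment of the integers; a vanishing y_i contributes the
    factor 1. *)
Lemma egf_LP_factorization (R : realType) (g : nat -> R) (B : R) :
  (forall k, 0 < g k) -> (forall k, g k * k`!%:R <= g 0%N * B ^+ k) ->
  multiplier_sequence g -> LP_factorization (egf g).
Proof.
move=> g0 gB gM; have [y [y0 yD yd yP]] := egf_product g0 gB gM.
have yn i j : (i <= j)%N -> y j <= y i.
  by move/subnKC <-; elim: (j - i)%N => [|k IH]; rewrite ?addn0 ?addnS//;
    exact: le_trans IH.
have [w wE] : exists omega, forall k, below omega k = (0 < y k).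
  have [yz|/forallNP yz] := pselect (exists i, y i == 0); last first.
    by exists None => k /=; rewrite lt0r y0 andbT; apply/esym/negP/yz.
  case: (ex_minnP yz) => w /eqP w0 wmin; exists (Some w) => k /=.
  rewrite lt0r y0 andbT ltnNge; congr negb; apply/idP/idP => [wk|/wmin//].
  by rewrite eq_le y0 andbT -w0 yn.
exists (g 0%N), 0%N, 0, w, (fun k => (y k)^-1); split => //.
- by move=> k; rewrite wE invr_gt0.
- rewrite (_ : (fun n => _) = fun n => \sum_(0 <= k < n) y k); last first.
    apply/funext => n; rewrite big_mkcond; apply: eq_bigr => k _.
    rewrite wE invrK; case: ifPn => //; rewrite -leNgt => yk.
    by apply/le_anti; rewrite y0 yk.
  apply: nondecreasing_is_cvgn; first exact: nondecreasing_series.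
  exists ((B * expR 1 ^+ 2) *+ 2) => _ [n _ <-].
  exact: sum_quadratic_decay_le2.
- move=> z.
  have -> : cexp (0%:C * z) = 1.
    (* The partial sum of length 0 is 0 and all the others are 1, hence the
       shift of the index. *)
    apply: cvg_lim => //; rewrite -cvg_shiftS mul0r.
    rewrite (_ : (fun n => _) = fun=> 1); first exact: cvg_cst.
    apply/funext => n; rewrite /series /= big_nat_recl//= expr0 fact0 divr1.
    by rewrite big1 ?addr0// => k _; rewrite expr0n mul0r.
  rewrite expr0 !mulr1 (_ : (fun n => _) =
      fun n => \prod_(0 <= k < n) (1 + (y k)%:C * z)); last first.
    apply/funext => n; rewrite big_mkcond; apply: eq_bigr => k _.
    rewrite wE -fmorphV invrK mulrC; case: ifPn => //; rewrite -leNgt => yk.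
    by rewrite (_ : y k = 0) ?mul0r ?addr0//; apply/le_anti; rewrite y0 yk.
  by rewrite (cvg_lim _ (yP z))// mulrC divfK// fmorph_eq0 gt_eqF.
Qed.

Theorem theorem11 (R : realType) :
  LP_plus (egf (gamma_seq R)) /\ multiplier_sequence (gamma_seq R).
Proof.
have gM := @gamma_seq_multiplier R.
have g0 := @gamma_seq_gt0 R.
have gB := @gamma_seq_growth R.
have gE := real_entire_egf g0 gB.
split=> //; split; last by exists (gamma_seq R); split => // k; exact/ltW/g0.
split; first by exists (gamma_seq R).
by left; exact: egf_LP_factorization g0 gB gM.
Qed.
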